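(* For all formulas $\phi,\psi$ built from proposition letters, $\top,\bot,\wedge,\vee,\Rightarrow$: the consequence pair $\phi\trianglelefteq\psi$ belongs to $\mathbf{PCL}$ if and only if the formula $\phi\to\psi$ is a theorem of $\mathbf{ICK}$.
   Context: $\mathbf{CL}(\Gamma)$ is the smallest set of consequence pairs $\phi\trianglelefteq\psi$ (between formulas $\phi::=p\mid\top\mid\bot\mid\phi\wedge\phi\mid\phi\vee\phi\mid\phi\Rightarrow\phi$) containing $\Gamma$, closed under uniform substitution, containing $p\trianglelefteq\top$, $\bot\trianglelefteq p$, $p\trianglelefteq p$, $p\wedge q\trianglelefteq p$, $p\wedge q\trianglelefteq q$, $p\trianglelefteq p\vee q$, $q\trianglelefteq p\vee q$, $\top\trianglelefteq p\Rightarrow\top$, $p\Rightarrow(q\wedge r)\trianglelefteq(p\Rightarrow q)\wedge(p\Rightarrow r)$, $(p\Rightarrow q)\wedge(p\Rightarrow r)\trianglelefteq p\Rightarrow(q\wedge r)$, closed under transitivity, $\wedge$-introduction (from $r\trianglelefteq p,r\trianglelefteq q$ infer $r\trianglelefteq p\wedge q$), $\vee$-elimination (from $p\trianglelefteq r,q\trianglelefteq r$ infer $p\vee q\trianglelefteq r$), and congruence for $\Rightarrow$ in each argument (from $p\trianglelefteq q,q\trianglelefteq p$ infer $p\Rightarrow r\trianglelefteq q\Rightarrow r$ and $r\Rightarrow p\trianglelefteq r\Rightarrow q$). $\mathbf{PCL}:=\mathbf{CL}(\{p\wedge(q\vee r)\trianglelefteq(p\wedge q)\vee(p\wedge r)\})$.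 $\mathbf{ICK}$ (intuitionistic conditional logic, over the same letters) has formulas $\phi::=p\mid\top\mid\bot\mid\phi\wedge\phi\mid\phi\vee\phi\mid\phi\to\phi\mid\phi\Rightarrow\phi$ and is obtained from an axiomatisation of intuitionistic propositional logic (with $\to$ the intuitionistic implication) by adding the axioms $p\Rightarrow\top$, $(p\Rightarrow(q\wedge r))\to((p\Rightarrow q)\wedge(p\Rightarrow r))$, $((p\Rightarrow q)\wedge(p\Rightarrow r))\to(p\Rightarrow(q\wedge r))$, the congruence rules (from theorems $\phi\leftrightarrow\psi$ infer $(\phi\Rightarrow\chi)\leftrightarrow(\psi\Rightarrow\chi)$ and $(\chi\Rightarrow\phi)\leftrightarrow(\chi\Rightarrow\psi)$), and closing under modus ponens and uniform substitution. *)

(* Defs.v *)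
Inductive cform (L : Type) : Type :=
| cvar (p : L)
| ctop
| cbot
| cand (a b : cform L)
| cor (a b : cform L)
| ccond (a b : cform L).

Arguments cvar {L} p.
Arguments ctop {L}.
Arguments cbot {L}.
Arguments cand {L} a b.
Arguments cor {L} a b.
Arguments ccond {L} a b.

Inductive iform (L : Type) : Type :=
| ivar (p : L)
| itop
| ibot
| iand (a b : iform L)
| ior (a b : iform L)
| iimp (a b : iform L)
| icond (a b : iform L).

Arguments ivar {L} p.
Arguments itop {L}.
Arguments ibot {L}.
Arguments iand {L} a b.
Arguments ior {L} a b.
Arguments iimp {L} a b.
Arguments icond {L} a b.

Declare Scope cform_scope.
Delimit Scope cform_scope with cform.
Bind Scope cform_scope with cform.
Declare Scope iform_scope.
Delimit Scope iform_scope with iform.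
Bind Scope iform_scope with iform.

Notation "⊤" := ctop (at level 0) : cform_scope.
Notation "⊥" := cbot (at level 0) : cform_scope.
Notation "a ∧ b" := (cand a b) (at level 40, left associativity) : cform_scope.
Notation "a ∨ b" := (cor a b) (at level 50, left associativity) : cform_scope.
Notation "a ⇒ b" := (ccond a b) (at level 55, right associativity) : cform_scope.

Notation "⊤" := itop (at level 0) : iform_scope.
Notation "⊥" := ibot (at level 0) : iform_scope.
Notation "a ∧ b" := (iand a b) (at level 40, left associativity) : iform_scope.
Notation "a ∨ b" := (ior a b) (at level 50, left associativity) : iform_scope.
Notation "a ⇒ b" := (icond a b) (at level 55, right associativity) : iform_scope.
Notation "a → b" := (iimp a b) (at level 60, right associativity) : iform_scope.
Notation "a ↔ b" := (iand (iimp a b) (iimp b a))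
  (at level 65, no associativity) : iform_scope.

Fixpoint csubst {L : Type} (s : L -> cform L) (a : cform L) : cform L :=
  match a with
  | cvar p => s p
  | ctop => ctop
  | cbot => cbot
  | cand b c => cand (csubst s b) (csubst s c)
  | cor b c => cor (csubst s b) (csubst s c)
  | ccond b c => ccond (csubst s b) (csubst s c)
  end.

Fixpoint isubst {L : Type} (s : L -> iform L) (a : iform L) : iform L :=
  match a with
  | ivar p => s p
  | itop => itop
  | ibot => ibot
  | iand b c => iand (isubst s b) (isubst s c)
  | ior b c => ior (isubst s b) (isubst s c)
  | iimp b c => iimp (isubst s b) (isubst s c)
  | icond b c => icond (isubst s b) (isubst s c)
  end.

Fixpoint embed {L : Type} (a : cform L) : iform L :=
  match a with
  | cvar p => ivar p
  | ctop => itop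
  | cbot => ibot
  | cand b c => iand (embed b) (embed c)
  | cor b c => ior (embed b) (embed c)
  | ccond b c => icond (embed b) (embed c)
  end.

(* [CL G a b]: the consequence pair of [a] and [b] belongs to CL(G).  In the
   axioms [p], [q], [r] range over letters, in the rules [a], [b], [c] range
   over formulas; arbitrary instances of the axioms come from [CL_subst], which
   needs at least three letters in [L] to reach all of them. *)
Inductive CL {L : Type} (G : cform L -> cform L -> Prop) :
    cform L -> cform L -> Prop :=
| CL_ax a b : G a b -> CL G a b
| CL_subst s a b : CL G a b -> CL G (csubst s a) (csubst s b)
| CL_top p : CL G (cvar p) ⊤
| CL_bot p : CL G ⊥ (cvar p)
| CL_refl p : CL G (cvar p) (cvar p)
| CL_andl p q : CL G (cvar p ∧ cvar q) (cvar p)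
| CL_andr p q : CL G (cvar p ∧ cvar q) (cvar q)
| CL_orl p q : CL G (cvar p) (cvar p ∨ cvar q)
| CL_orr p q : CL G (cvar q) (cvar p ∨ cvar q)
| CL_cond_top p : CL G ⊤ (cvar p ⇒ ⊤)
| CL_cond_and p q r :
    CL G (cvar p ⇒ (cvar q ∧ cvar r)) ((cvar p ⇒ cvar q) ∧ (cvar p ⇒ cvar r))
| CL_and_cond p q r :
    CL G ((cvar p ⇒ cvar q) ∧ (cvar p ⇒ cvar r)) (cvar p ⇒ (cvar q ∧ cvar r))
| CL_trans a b c : CL G a b -> CL G b c -> CL G a c
| CL_and_intro a b c : CL G c a -> CL G c b -> CL G c (a ∧ b)
| CL_or_elim a b c : CL G a c -> CL G b c -> CL G (a ∨ b) c
| CL_congl a b c : CL G a b -> CL G b a -> CL G (a ⇒ c) (b ⇒ c)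
| CL_congr a b c : CL G a b -> CL G b a -> CL G (c ⇒ a) (c ⇒ b).

Inductive distributivity {L : Type} : cform L -> cform L -> Prop :=
| Distributivity p q r :
    distributivity (cvar p ∧ (cvar q ∨ cvar r))
                   ((cvar p ∧ cvar q) ∨ (cvar p ∧ cvar r)).

Definition PCL {L : Type} : cform L -> cform L -> Prop := CL distributivity.

(* A standard Hilbert axiomatisation of intuitionistic propositional logic;
   negation is defined as implication of [⊥]. *)
Inductive IPL_axiom {L : Type} : iform L -> Prop :=
| IPL_K p q : IPL_axiom (ivar p → (ivar q → ivar p))
| IPL_S p q r :
    IPL_axiom ((ivar p → (ivar q → ivar r)) →
               ((ivar p → ivar q) → (ivar p → ivar r)))
| IPL_andl p q : IPL_axiom ((ivar p ∧ ivar q) → ivar p)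
| IPL_andr p q : IPL_axiom ((ivar p ∧ ivar q) → ivar q)
| IPL_and_intro p q : IPL_axiom (ivar p → (ivar q → (ivar p ∧ ivar q)))
| IPL_orl p q : IPL_axiom (ivar p → (ivar p ∨ ivar q))
| IPL_orr p q : IPL_axiom (ivar q → (ivar p ∨ ivar q))
| IPL_or_elim p q r :
    IPL_axiom ((ivar p → ivar r) →
               ((ivar q → ivar r) → ((ivar p ∨ ivar q) → ivar r)))
| IPL_bot p : IPL_axiom (⊥ → ivar p)
| IPL_top : IPL_axiom ⊤.

Inductive ICK {L : Type} : iform L -> Prop :=
| ICK_IPL a : IPL_axiom a -> ICK a
| ICK_cond_top p : ICK (ivar p ⇒ ⊤)
| ICK_cond_and p q r :
    ICK ((ivar p ⇒ (ivar q ∧ ivar r)) →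
         ((ivar p ⇒ ivar q) ∧ (ivar p ⇒ ivar r)))
| ICK_and_cond p q r :
    ICK (((ivar p ⇒ ivar q) ∧ (ivar p ⇒ ivar r)) →
         (ivar p ⇒ (ivar q ∧ ivar r)))
| ICK_congl a b c : ICK (a ↔ b) -> ICK ((a ⇒ c) ↔ (b ⇒ c))
| ICK_congr a b c : ICK (a ↔ b) -> ICK ((c ⇒ a) ↔ (c ⇒ b))
| ICK_mp a b : ICK (a → b) -> ICK a -> ICK b
| ICK_subst s a : ICK a -> ICK (isubst s a).

(* Main.v *)
(** Soundness of PCL in ICK is a direct derivation.  For the converse, the
    ideals of the Lindenbaum lattice of PCL form a Heyting algebra, and the map
    sending [a] to the principal ideal of [a] embeds the lattice into it.  The
    conditional extends to ideals by
      [I ⇒ J = {c | whenever I is the principal ideal of a,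
                    c ⊴ a ⇒ b for some b in J}],
    which still preserves finite meets in [J] and agrees with the original
    conditional on principal ideals.  So ICK is sound for the algebra of ideals,
    and a theorem [embed phi → embed psi] puts [phi] in the principal ideal of
    [psi]. *)

From Stdlib Require Import ClassicalEpsilon.
Require Import Defs.

(** * Arbitrary instances of the axioms from three distinct letters *)

Definition three_letters (L : Type) : Prop :=
  exists p q r : L, p <> q /\ p <> r /\ q <> r.

(** The axioms mention only letters, so an instance at given formulas comes from a substitution
    taking prescribed values at three letters. Excluded middle decides equality of letters. *)
Lemma three_letters_assign {L : Type} (HL : three_letters L) (T : Type) (a b c : T) :
  exists (s : L -> T) (p q r : L), s p = a /\ s q = b /\ s r = c.
Proof.
  destruct HL as (p & q & r & hpq & hpr & hqr).
  exists (fun l => if excluded_middle_informative (l = p) then a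
           else if excluded_middle_informative (l = q) then b else c), p, q, r.
  repeat split;
    repeat (destruct excluded_middle_informative; try congruence).
Qed.

Ltac instantiate_letters HL a b c ax :=
  let s := fresh "s" in
  let p := fresh "p" in
  let q := fresh "q" in
  let r := fresh "r" in
  let Hp := fresh "Hp" in
  let Hq := fresh "Hq" in
  let Hr := fresh "Hr" in
  let H := fresh "H" in
  destruct (three_letters_assign HL _ a b c) as (s & p & q & r & Hp & Hq & Hr);
  pose proof (ax s p q r) as H; simpl in H;
  rewrite ?Hp, ?Hq, ?Hr in H; exact H.

(** * Derivations in ICK *)

Section ICKDerivations.
Context {L : Type} (HL : three_letters L).
Local Open Scope iform_scope.
Implicit Types a b c : iform L.

Lemma ick_K a b : ICK (a → b → a).
Proof.
  instantiate_letters HL a b a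
    (fun s (p q r : L) => ICK_subst s _ (ICK_IPL _ (IPL_K p q))).
Qed.

Lemma ick_S a b c : ICK ((a → b → c) → (a → b) → a → c).
Proof.
  instantiate_letters HL a b c
    (fun s (p q r : L) => ICK_subst s _ (ICK_IPL _ (IPL_S p q r))).
Qed.

Lemma ick_andl a b : ICK (a ∧ b → a).
Proof.
  instantiate_letters HL a b a
    (fun s (p q r : L) => ICK_subst s _ (ICK_IPL _ (IPL_andl p q))).
Qed.

Lemma ick_andr a b : ICK (a ∧ b → b).
Proof.
  instantiate_letters HL a b a
    (fun s (p q r : L) => ICK_subst s _ (ICK_IPL _ (IPL_andr p q))).
Qed.

Lemma ick_pair a b : ICK (a → b → a ∧ b).
Proof.
  instantiate_letters HL a b a
    (fun s (p q r : L) => ICK_subst s _ (ICK_IPL _ (IPL_and_intro p q))).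
Qed.

Lemma ick_orl a b : ICK (a → a ∨ b).
Proof.
  instantiate_letters HL a b a
    (fun s (p q r : L) => ICK_subst s _ (ICK_IPL _ (IPL_orl p q))).
Qed.

Lemma ick_orr a b : ICK (b → a ∨ b).
Proof.
  instantiate_letters HL a b a
    (fun s (p q r : L) => ICK_subst s _ (ICK_IPL _ (IPL_orr p q))).
Qed.

Lemma ick_case a b c : ICK ((a → c) → (b → c) → a ∨ b → c).
Proof.
  instantiate_letters HL a b c
    (fun s (p q r : L) => ICK_subst s _ (ICK_IPL _ (IPL_or_elim p q r))).
Qed.

Lemma ick_const a b : ICK b -> ICK (a → b).
Proof. exact (ICK_mp _ _ (ick_K b a)). Qed.

(** Modus ponens under a hypothesis [a]; with [ick_const] it stands in for a deduction theorem. *)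
Lemma ick_app a b c : ICK (a → b → c) -> ICK (a → b) -> ICK (a → c).
Proof. intros H; apply ICK_mp; exact (ICK_mp _ _ (ick_S a b c) H). Qed.

Lemma ick_refl a : ICK (a → a).
Proof. exact (ick_app _ _ _ (ick_K a (a → a)) (ick_K a a)). Qed.

Lemma ick_trans a b c : ICK (a → b) -> ICK (b → c) -> ICK (a → c).
Proof.
  intros Hab Hbc; exact (ick_app _ _ _ (ick_const a _ Hbc) Hab).
Qed.

Lemma ick_and_intro a b c : ICK (c → a) -> ICK (c → b) -> ICK (c → a ∧ b).
Proof.
  intros Ha; apply ick_app; exact (ick_trans _ _ _ Ha (ick_pair a b)).
Qed.

Lemma ick_or_elim a b c : ICK (a → c) -> ICK (b → c) -> ICK (a ∨ b → c).
Proof.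
  intros Ha; apply ICK_mp; exact (ICK_mp _ _ (ick_case a b c) Ha).
Qed.

Lemma ick_curry a b c : ICK (a ∧ b → c) -> ICK (a → b → c).
Proof.
  intros H; apply (ick_trans _ _ _ (ick_pair a b)).
  exact (ICK_mp _ _ (ick_S b (a ∧ b) c) (ick_const _ _ H)).
Qed.

(** The conjunct [a] is supplied last: disjunction elimination acts on [b ∨ c] alone, with an
    implication from [a] as its target. *)
Lemma ick_distributivity a b c : ICK (a ∧ (b ∨ c) → (a ∧ b) ∨ (a ∧ c)).
Proof.
  apply ick_app with a; [|apply ick_andl].
  apply (ick_trans _ _ _ (ick_andr a (b ∨ c))).
  apply ick_or_elim; apply ick_curry.
  - apply ick_trans with (a ∧ b); [|apply ick_orl].
    apply ick_and_intro; [apply ick_andr | apply ick_andl].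
  - apply ick_trans with (a ∧ c); [|apply ick_orr].
    apply ick_and_intro; [apply ick_andr | apply ick_andl].
Qed.

Lemma ick_iff_intro a b : ICK (a → b) -> ICK (b → a) -> ICK (a ↔ b).
Proof. intros H; apply ICK_mp; exact (ICK_mp _ _ (ick_pair _ _) H). Qed.

Lemma ick_iff_mp a b : ICK (a ↔ b) -> ICK (a → b).
Proof. exact (ICK_mp _ _ (ick_andl _ _)). Qed.

Lemma embed_csubst (s : L -> cform L) (a : cform L) :
  embed (csubst s a) = isubst (fun p => embed (s p)) (embed a).
Proof. induction a; simpl; congruence. Qed.

(** Induction on the derivation. In the congruence cases the two induction hypotheses form the
    biconditional that the rules of ICK require. *)
Lemma pcl_ick (a b : cform L) : PCL a b -> ICK (embed a → embed b).
Proof.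
  induction 1; simpl in *.
  - destruct H; simpl; apply ick_distributivity.
  - rewrite !embed_csubst; exact (ICK_subst _ _ IHCL).
  - apply ick_const, ICK_IPL, IPL_top.
  - apply ICK_IPL, IPL_bot.
  - apply ick_refl.
  - apply ick_andl.
  - apply ick_andr.
  - apply ick_orl.
  - apply ick_orr.
  - apply ick_const, ICK_cond_top.
  - apply ICK_cond_and.
  - apply ICK_and_cond.
  - eapply ick_trans; eassumption.
  - now apply ick_and_intro.
  - now apply ick_or_elim.
  - now apply ick_iff_mp, ICK_congl, ick_iff_intro.
  - now apply ick_iff_mp, ICK_congr, ick_iff_intro.
Qed.

End ICKDerivations.

(** * The lattice of PCL and its ideals *)

Section Ideals.
Context {L : Type} (HL : three_letters L).
Local Open Scope cform_scope.
Local Notation "a ⊴ b" := (PCL a b) (at level 70).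
Implicit Types (a b c d : cform L) (I J K : cform L -> Prop).

(** * Order-theoretic rules of PCL *)

Lemma pcl_refl a : a ⊴ a.
Proof.
  instantiate_letters HL a a a
    (fun s (p q r : L) => CL_subst distributivity s _ _ (CL_refl _ p)).
Qed.

Lemma pcl_top a : a ⊴ ⊤.
Proof.
  instantiate_letters HL a a a
    (fun s (p q r : L) => CL_subst distributivity s _ _ (CL_top _ p)).
Qed.

Lemma pcl_bot a : ⊥ ⊴ a.
Proof.
  instantiate_letters HL a a a
    (fun s (p q r : L) => CL_subst distributivity s _ _ (CL_bot _ p)).
Qed.

Lemma pcl_andl a b : a ∧ b ⊴ a.
Proof.
  instantiate_letters HL a b a
    (fun s (p q r : L) => CL_subst distributivity s _ _ (CL_andl _ p q)).
Qed.

Lemma pcl_andr a b : a ∧ b ⊴ b.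
Proof.
  instantiate_letters HL a b a
    (fun s (p q r : L) => CL_subst distributivity s _ _ (CL_andr _ p q)).
Qed.

Lemma pcl_orl a b : a ⊴ a ∨ b.
Proof.
  instantiate_letters HL a b a
    (fun s (p q r : L) => CL_subst distributivity s _ _ (CL_orl _ p q)).
Qed.

Lemma pcl_orr a b : b ⊴ a ∨ b.
Proof.
  instantiate_letters HL a b a
    (fun s (p q r : L) => CL_subst distributivity s _ _ (CL_orr _ p q)).
Qed.

Lemma pcl_cond_top a : ⊤ ⊴ (a ⇒ ⊤).
Proof.
  instantiate_letters HL a a a
    (fun s (p q r : L) => CL_subst distributivity s _ _ (CL_cond_top _ p)).
Qed.

Lemma pcl_cond_and a b c : (a ⇒ b ∧ c) ⊴ (a ⇒ b) ∧ (a ⇒ c).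
Proof.
  instantiate_letters HL a b c
    (fun s (p q r : L) => CL_subst distributivity s _ _ (CL_cond_and _ p q r)).
Qed.

Lemma pcl_and_cond a b c : (a ⇒ b) ∧ (a ⇒ c) ⊴ (a ⇒ b ∧ c).
Proof.
  instantiate_letters HL a b c
    (fun s (p q r : L) => CL_subst distributivity s _ _ (CL_and_cond _ p q r)).
Qed.

Lemma pcl_distributivity a b c : a ∧ (b ∨ c) ⊴ (a ∧ b) ∨ (a ∧ c).
Proof.
  instantiate_letters HL a b c (fun s (p q r : L) =>
    CL_subst distributivity s _ _ (CL_ax _ _ _ (Distributivity p q r))).
Qed.

Lemma pcl_trans a b c : a ⊴ b -> b ⊴ c -> a ⊴ c.
Proof. apply CL_trans. Qed.

Lemma pcl_and_intro a b c : c ⊴ a -> c ⊴ b -> c ⊴ a ∧ b.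
Proof. apply CL_and_intro. Qed.

Lemma pcl_or_elim a b c : a ⊴ c -> b ⊴ c -> a ∨ b ⊴ c.
Proof. apply CL_or_elim. Qed.

Lemma pcl_and_left a b c : a ⊴ c -> a ∧ b ⊴ c.
Proof. exact (pcl_trans _ _ _ (pcl_andl a b)). Qed.

Lemma pcl_and_right a b c : b ⊴ c -> a ∧ b ⊴ c.
Proof. exact (pcl_trans _ _ _ (pcl_andr a b)). Qed.

Lemma pcl_and_mono a b c d : a ⊴ c -> b ⊴ d -> a ∧ b ⊴ c ∧ d.
Proof.
  intros Hac Hbd; apply pcl_and_intro.
  - exact (pcl_trans _ _ _ (pcl_andl a b) Hac).
  - exact (pcl_trans _ _ _ (pcl_andr a b) Hbd).
Qed.

Lemma pcl_or_mono a b c d : a ⊴ c -> b ⊴ d -> a ∨ b ⊴ c ∨ d.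
Proof.
  intros Hac Hbd; apply pcl_or_elim.
  - exact (pcl_trans _ _ _ Hac (pcl_orl c d)).
  - exact (pcl_trans _ _ _ Hbd (pcl_orr c d)).
Qed.

Lemma pcl_distributivity_r a b c : (a ∨ b) ∧ c ⊴ (a ∧ c) ∨ (b ∧ c).
Proof.
  apply pcl_trans with (c ∧ (a ∨ b)).
  - apply pcl_and_intro; [apply pcl_andr | apply pcl_andl].
  - apply (pcl_trans _ _ _ (pcl_distributivity c a b)).
    apply pcl_or_mono; apply pcl_and_intro; apply pcl_andr || apply pcl_andl.
Qed.

(** If [b ⊴ c] then [b] and [b ∧ c] are equivalent, so congruence and preservation of meets yield
    monotonicity. *)
Lemma pcl_cond_mono a b c : b ⊴ c -> (a ⇒ b) ⊴ (a ⇒ c).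
Proof.
  intros Hbc; apply pcl_trans with (a ⇒ b ∧ c).
  - apply CL_congr; [|apply pcl_andl].
    apply pcl_and_intro; [apply pcl_refl | exact Hbc].
  - exact (pcl_trans _ _ _ (pcl_cond_and a b c) (pcl_andr _ _)).
Qed.

(** * Ideals, their operations, and principal ideals *)

Record ideal I : Prop := {
  ideal_bot : I ⊥;
  ideal_down : forall a b, a ⊴ b -> I b -> I a;
  ideal_or : forall a b, I a -> I b -> I (a ∨ b)
}.

Definition principal a : cform L -> Prop := fun c => c ⊴ a.

Definition ideal_join I J : cform L -> Prop :=
  fun c => exists a b, I a /\ J b /\ c ⊴ a ∨ b.

(** The Heyting implication: for ideals [I] and [J], the largest ideal whose intersection with [I]
    lies in [J]. *)
Definition ideal_imp I J : cform L -> Prop :=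
  fun c => forall a, I a -> J (c ∧ a).

(** Quantifying over all generators of [I] avoids choosing one. If [I] is not principal the
    condition is vacuous and the value is the whole lattice. *)
Definition ideal_cond I J : cform L -> Prop :=
  fun c => forall a, (forall d, I d <-> principal a d) ->
    exists b, J b /\ c ⊴ (a ⇒ b).

Lemma ideal_principal a : ideal (principal a).
Proof.
  split.
  - apply pcl_bot.
  - intros b c; apply pcl_trans.
  - intros b c; apply pcl_or_elim.
Qed.

Lemma ideal_ideal_join I J : ideal I -> ideal J -> ideal (ideal_join I J).
Proof.
  intros HI HJ; split.
  - exists ⊥, ⊥; split; [now apply ideal_bot|].
    split; [now apply ideal_bot | apply pcl_bot].
  - intros a b Hab (i & j & Hi & Hj & H); exists i, j.
    eauto using pcl_trans.
  - intros a b (i & j & Hi & Hj & H) (i' & j' & Hi' & Hj' & H').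
    exists (i ∨ i'), (j ∨ j').
    split; [now apply ideal_or|]; split; [now apply ideal_or|].
    apply pcl_or_elim.
    + apply (pcl_trans _ _ _ H), pcl_or_mono; apply pcl_orl.
    + apply (pcl_trans _ _ _ H'), pcl_or_mono; apply pcl_orr.
Qed.

(** Closure under joins is where distributivity enters. *)
Lemma ideal_ideal_imp I J : ideal J -> ideal (ideal_imp I J).
Proof.
  intros HJ; split.
  - intros a _; apply (ideal_down _ HJ _ ⊥); [apply pcl_andl|].
    now apply ideal_bot.
  - intros a b Hab Hb c Hc; apply (ideal_down _ HJ _ (b ∧ c)); [|now apply Hb].
    apply pcl_and_mono; [exact Hab | apply pcl_refl].
  - intros a b Ha Hb c Hc.
    apply (ideal_down _ HJ _ _ (pcl_distributivity_r a b c)).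
    apply ideal_or; auto.
Qed.

(** For a join, the join of the two witnesses in [J] serves, by monotonicity of the conditional in
    its second argument. *)
Lemma ideal_ideal_cond I J : ideal J -> ideal (ideal_cond I J).
Proof.
  intros HJ; split.
  - intros a _; exists ⊥; split; [now apply ideal_bot | apply pcl_bot].
  - intros a b Hab Hb d Hd; destruct (Hb d Hd) as (e & He & H).
    exists e; eauto using pcl_trans.
  - intros a b Ha Hb d Hd.
    destruct (Ha d Hd) as (e & He & H), (Hb d Hd) as (f & Hf & H').
    exists (e ∨ f); split; [now apply ideal_or|]; apply pcl_or_elim.
    + apply (pcl_trans _ _ _ H), pcl_cond_mono, pcl_orl.
    + apply (pcl_trans _ _ _ H'), pcl_cond_mono, pcl_orr.
Qed.

Lemma principal_or a b c :
  ideal_join (principal a) (principal b) c <-> principal (a ∨ b) c.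
Proof.
  split.
  - intros (i & j & Hi & Hj & H); apply (pcl_trans _ _ _ H).
    now apply pcl_or_mono.
  - intros H; exists a, b; exact (conj (pcl_refl a) (conj (pcl_refl b) H)).
Qed.

Lemma principal_inj a b : (forall c, principal a c <-> principal b c) ->
  a ⊴ b /\ b ⊴ a.
Proof.
  intros H; split; [apply (proj1 (H a)) | apply (proj2 (H b))]; apply pcl_refl.
Qed.

(** One direction tests the generator [a] itself; in the other, any generator is equivalent to [a],
    and congruence in the first argument applies. *)
Lemma principal_cond a b c :
  ideal_cond (principal a) (principal b) c <-> principal (a ⇒ b) c.
Proof.
  split.
  - intros H; destruct (H a) as (d & Hd & H'); [tauto|].
    apply (pcl_trans _ _ _ H'), pcl_cond_mono, Hd.
  - intros H d Hd; exists b; split; [apply pcl_refl|].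
    destruct (principal_inj _ _ Hd).
    apply (pcl_trans _ _ _ H); now apply CL_congl.
Qed.

(** * Soundness of ICK for the algebra of ideals *)

Fixpoint interp (v : L -> cform L -> Prop) (a : iform L) : cform L -> Prop :=
  match a with
  | ivar p => v p
  | itop => fun _ => True
  | ibot => principal ⊥
  | iand a b => fun c => interp v a c /\ interp v b c
  | ior a b => ideal_join (interp v a) (interp v b)
  | iimp a b => ideal_imp (interp v a) (interp v b)
  | icond a b => ideal_cond (interp v a) (interp v b)
  end.

Lemma ideal_interp v (a : iform L) :
  (forall p, ideal (v p)) -> ideal (interp v a).
Proof.
  intros Hv; induction a; simpl.
  - apply Hv.
  - now split.
  - apply ideal_principal.
  - destruct IHa1, IHa2; split; firstorder.
  - now apply ideal_ideal_join.
  - now apply ideal_ideal_imp.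
  - now apply ideal_ideal_cond.
Qed.

Lemma interp_isubst v (s : L -> iform L) (a : iform L) :
  interp v (isubst s a) = interp (fun p => interp v (s p)) a.
Proof. induction a; simpl; rewrite ?IHa1, ?IHa2; reflexivity. Qed.

Lemma ideal_cond_ext_l I I' J c : (forall d, I d <-> I' d) ->
  ideal_cond I J c -> ideal_cond I' J c.
Proof.
  intros HI H a Ha; apply H; intros d; now rewrite HI.
Qed.

Lemma ideal_cond_mono_r I J J' c : (forall d, J d -> J' d) ->
  ideal_cond I J c -> ideal_cond I J' c.
Proof.
  intros HJ H a Ha; destruct (H a Ha) as (b & Hb & Hc); eauto.
Qed.

Lemma ideal_join_ext I I' J J' c :
  (forall d, I d <-> I' d) -> (forall d, J d <-> J' d) ->
  ideal_join I J c <-> ideal_join I' J' c.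
Proof. intros HI HJ; split; intros (a & b & H); exists a, b; firstorder. Qed.

(** Evaluation at [⊤] turns validity of an implication into inclusion; conversely [c ∧ a] lies below
    [a]. *)
Lemma ideal_imp_total I J : ideal J ->
  (forall c, ideal_imp I J c) <-> (forall a, I a -> J a).
Proof.
  intros HJ; split.
  - intros H a Ha; apply (ideal_down _ HJ _ (⊤ ∧ a)); [|now apply H].
    apply pcl_and_intro; [apply pcl_top | apply pcl_refl].
  - intros H c a Ha; apply (ideal_down _ HJ _ a); [apply pcl_andr | auto].
Qed.

Lemma interp_iff v (a b : iform L) : (forall p, ideal (v p)) ->
  (forall c, interp v (a ↔ b)%iform c) <->
  (forall d, interp v a d <-> interp v b d).
Proof.
  intros Hv.
  pose proof (ideal_imp_total (interp v a) _ (ideal_interp v b Hv)) as Hab.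
  pose proof (ideal_imp_total (interp v b) _ (ideal_interp v a Hv)) as Hba.
  simpl; firstorder.
Qed.

Lemma ipl_sound (a : iform L) v c :
  IPL_axiom a -> (forall p, ideal (v p)) -> interp v a c.
Proof.
  intros Ha Hv; pose proof (fun p => ideal_down _ (Hv p)) as down.
  revert c; destruct Ha; simpl; trivial; intros x y Hy.
  - intros z Hz; apply (down p _ y); [|exact Hy].
    exact (pcl_trans _ _ _ (pcl_andl _ _) (pcl_andr _ _)).
  - intros z Hz w Hw.
    (* Applying [y] to [w] gives an element of the implication from [v q] to [v r], which is then
       applied to [z ∧ w] in [v q]. *)
    apply (down r _ ((y ∧ w) ∧ (z ∧ w))); [|now apply Hy; [|apply Hz]].
    repeat apply pcl_and_intro; auto 6 using pcl_andr, pcl_and_left, pcl_and_right, pcl_refl.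
  - apply (down p _ y); [apply pcl_andr | apply Hy].
  - apply (down q _ y); [apply pcl_andr | apply Hy].
  - intros z Hz; split.
    + apply (down p _ y); [|exact Hy].
      apply pcl_and_left, pcl_andr.
    + apply (down q _ z); [apply pcl_andr | exact Hz].
  - exists y, ⊥; split; [exact Hy | split; [now apply ideal_bot|]].
    exact (pcl_trans _ _ _ (pcl_andr _ _) (pcl_orl _ _)).
  - exists ⊥, y; split; [now apply ideal_bot | split; [exact Hy|]].
    exact (pcl_trans _ _ _ (pcl_andr _ _) (pcl_orr _ _)).
  - intros z Hz w (i & j & Hi & Hj & Hw).
    (* Distributing [y ∧ z] over [i ∨ j] separates the cases: [y] takes [i] into [v r], and [z]
       takes [j] there. *)
    apply (down r _ ((y ∧ i) ∨ (z ∧ j))).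
    + apply pcl_trans with ((y ∧ z) ∧ (i ∨ j)).
      * apply pcl_and_mono; [apply pcl_and_mono; apply pcl_andr || apply pcl_refl | exact Hw].
      * apply (pcl_trans _ _ _ (pcl_distributivity _ _ _)).
        apply pcl_or_mono; apply pcl_and_mono;
          apply pcl_andl || apply pcl_andr || apply pcl_refl.
    + apply ideal_or; auto.
  - apply (down p _ ⊥); [|now apply ideal_bot].
    exact (pcl_trans _ _ _ (pcl_andr _ _) Hy).
Qed.

(** The valuation stays universally quantified in the induction, since the substitution rule
    replaces [v] by the values of the substituted formulas. *)
Lemma ick_sound (a : iform L) : ICK a ->
  forall v, (forall p, ideal (v p)) -> forall c, interp v a c.
Proof.
  induction 1; intros v Hv.
  - intros c; now apply ipl_sound.
  - intros c b Hb; exists ⊤; split; [exact I|].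
    exact (pcl_trans _ _ _ (pcl_top c) (pcl_cond_top b)).
  - simpl; apply ideal_imp_total.
    + exact (ideal_interp v ((ivar p ⇒ ivar q) ∧ (ivar p ⇒ ivar r))%iform Hv).
    + intros c Hc; split; (eapply ideal_cond_mono_r; [|exact Hc]); now intros d [].
  - simpl; apply ideal_imp_total.
    + exact (ideal_interp v (ivar p ⇒ (ivar q ∧ ivar r))%iform Hv).
    + intros c [Hq Hr] b Hb.
      destruct (Hq b Hb) as (d & Hd & Hcd), (Hr b Hb) as (e & He & Hce).
      (* Both witnesses belong to the same generator [b]; their meet lies in both ideals by downward
         closure. *)
      exists (d ∧ e); repeat split.
      * apply (ideal_down _ (Hv q) _ d); [apply pcl_andl | exact Hd].
      * apply (ideal_down _ (Hv r) _ e); [apply pcl_andr | exact He].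
      * apply pcl_trans with ((b ⇒ d) ∧ (b ⇒ e)); [|apply pcl_and_cond].
        now apply pcl_and_intro.
  - pose proof (proj1 (interp_iff v a b Hv) (IHICK v Hv)) as Hab.
    apply interp_iff; [exact Hv|]; simpl; intros d.
    split; apply ideal_cond_ext_l; intros e; rewrite (Hab e); tauto.
  - pose proof (proj1 (interp_iff v a b Hv) (IHICK v Hv)) as Hab.
    apply interp_iff; [exact Hv|]; simpl; intros d.
    split; apply ideal_cond_mono_r; apply Hab.
  - intros c.
    exact (proj1 (ideal_imp_total _ _ (ideal_interp v b Hv)) (IHICK1 v Hv)
             c (IHICK2 v Hv c)).
  - rewrite interp_isubst; apply IHICK; intros p; now apply ideal_interp.
Qed.

(** * Principal valuation and the converse direction *)

Definition principal_letter (p : L) : cform L -> Prop := principal (cvar p).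

(** Taking principal ideals commutes with every connective of [cform], and [embed] produces no
    implication. *)
Lemma interp_embed a c : interp principal_letter (embed a) c <-> principal a c.
Proof.
  revert c; induction a; simpl; intros c.
  - reflexivity.
  - split; trivial; intros _; apply pcl_top.
  - reflexivity.
  - rewrite IHa1, IHa2; split.
    + intros []; now apply pcl_and_intro.
    + split; apply (pcl_trans _ _ _ H); [apply pcl_andl | apply pcl_andr].
  - rewrite <- principal_or; now apply ideal_join_ext.
  - rewrite <- principal_cond; split; intros H.
    + eapply ideal_cond_ext_l; [exact IHa1|].
      eapply ideal_cond_mono_r; [|exact H]; apply IHa2.
    + apply ideal_cond_ext_l with (principal a1); [now symmetry|].
      eapply ideal_cond_mono_r; [|exact H]; apply IHa2.
Qed.

Lemma ick_pcl a b : ICK (embed a → embed b)%iform -> a ⊴ b.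
Proof.
  intros H.
  assert (Hv : forall p, ideal (principal_letter p)).
  { intros p; apply ideal_principal. }
  pose proof (proj1 (ideal_imp_total _ _ (ideal_interp _ (embed b) Hv))
                (ick_sound _ H _ Hv)) as Hab.
  (* The inclusion of ideals is applied to the generator [a] of the smaller one. *)
  apply interp_embed, Hab, interp_embed, pcl_refl.
Qed.

End Ideals.

Theorem theorem5p11 (L : Type) (p q r : L)
    (hpq : p <> q) (hpr : p <> r) (hqr : q <> r) (phi psi : cform L) :
  PCL phi psi <-> ICK (embed phi → embed psi).
Proof.
  assert (HL : three_letters L) by (now exists p, q, r).
  split; [apply pcl_ick, HL | apply ick_pcl, HL].
Qed.
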